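(* Let $k$ be a field, let $\mathcal{C}$ be a small $k$-linear abelian category, and let $\mathcal{F}:\mathcal{C}\to \mathrm{Vect}_k$ be a $k$-linear functor such that $\mathcal{F}(X)$ is finite dimensional for every $X\in\mathrm{Ob}(\mathcal{C})$. Let $\{i_X^U:\mathrm{Hom}(X,X)\to U\}_{X\in\mathrm{Ob}(\mathcal{C})}$ be a realization of $\mathrm{coend}(\mathcal{F})$. Then there exist unique linear maps $\Delta_U:U\to U\otimes U$ and $\epsilon_U:U\to k$ such that, for all $X\in\mathrm{Ob}(\mathcal{C})$, $$\Delta_U\circ i_X^U=(i_X^U\otimes i_X^U)\circ\Delta_X,\qquad \epsilon_U\circ i_X^U=\epsilon_X,$$ and $(U,\Delta_U,\epsilon_U)$ is a coalgebra over $k$.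
   Context: $\mathrm{Vect}_k$ is the category of vector spaces over $k$; $\otimes=\otimes_k$. For objects $X,Y$ of $\mathcal{C}$ write $\mathrm{Hom}(X,Y):=\mathrm{Hom}_k(\mathcal{F}(X),\mathcal{F}(Y))$ (all $k$-linear maps). A realization of $\mathrm{coend}(\mathcal{F})$ is a $k$-vector space $U$ together with linear maps $\{i_X^U:\mathrm{Hom}(X,X)\to U\}_{X\in\mathrm{Ob}(\mathcal{C})}$ such that: (1) for all objects $X,Y$, all $f\in\mathrm{Hom}_{\mathcal{C}}(Y,X)$ and all $T\in\mathrm{Hom}(X,Y)$, $i^U_X(\mathcal{F}(f)\circ T)=i^U_Y(T\circ\mathcal{F}(f))$; (2) for every $k$-vector space $W$ with linear maps $\{i_X^W:\mathrm{Hom}(X,X)\to W\}_{X\in\mathrm{Ob}(\mathcal{C})}$ satisfying the analogue of (1), there is a unique linear map $\varphi:U\to W$ with $\varphi\circ i_X^U=i_X^W$ for all $X\in\mathrm{Ob}(\mathcal{C})$. Coalgebra structure on $\mathrm{Hom}(X,X)$: for $\beta\in\mathcal{F}(X)^*$ and $x\in\mathcal{F}(X)$, $\beta\otimes x\in\mathrm{Hom}(X,X)$ denotes the map $y\mapsto\beta(y)x$; such maps span $\mathrm{Hom}(X,X)$. Let $\{x_i\}_{i=1}^n$ be a basis of $\mathcal{F}(X)$ with dual basis $\{x^i\}_{i=1}^n$ of $\mathcal{F}(X)^*$. Then $\Delta_X:\mathrm{Hom}(X,X)\to\mathrm{Hom}(X,X)\otimes\mathrm{Hom}(X,X)$ and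 $\epsilon_X:\mathrm{Hom}(X,X)\to k$ are the linear maps given by $\Delta_X(\beta\otimes x)=\sum_{i=1}^n(\beta\otimes x_i)\otimes(x^i\otimes x)$ and $\epsilon_X(\beta\otimes x)=\beta(x)$. *)

(* Defs.v *)
From HB Require Import structures.
From mathcomp Require Import all_boot all_order all_algebra.
From mathcomp Require Import boolp.

Set Implicit Arguments.
Unset Strict Implicit.
Unset Printing Implicit Defensive.

Import GRing.Theory.
Local Open Scope ring_scope.
Local Open Scope quotient_scope.

(* A list [:: (u1, v1); ...; (un, vn)] stands for the sum of the ui (x) vi;
   two lists denote the same tensor when no bilinear map distinguishes them.
   The universal property is [tens_liftE] together with [tens_ext]. *)

Section Tensor.
Variables (k : fieldType) (U V : lmodType k).
Implicit Types (s t : seq (U * V)) (W : lmodType k).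

Definition tens_eval W (b : U -> V -> W) s : W := \sum_(p <- s) b p.1 p.2.

Definition tens_rel s t : bool :=
  `[< forall W (b : {bilinear U -> V -> W}), tens_eval b s = tens_eval b t >].

Lemma tens_rel_refl : reflexive tens_rel.
Proof. by move=> s; apply/asboolP. Qed.

Lemma tens_rel_sym : symmetric tens_rel.
Proof. by move=> s t; apply/asboolP/asboolP => h W b; rewrite h. Qed.

Lemma tens_rel_trans : transitive tens_rel.
Proof.
by move=> t s u /asboolP h1 /asboolP h2; apply/asboolP => W b; rewrite h1 h2.
Qed.

Canonical tens_equiv := EquivRel tens_rel tens_rel_refl tens_rel_sym tens_rel_trans.

Definition tensor := {eq_quot tens_equiv}.

HB.instance Definition _ := Choice.on tensor.
HB.instance Definition _ := EqQuotient.on tensor.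

Lemma tens_piP s t :
  (forall W (b : {bilinear U -> V -> W}), tens_eval b s = tens_eval b t) ->
  \pi_tensor s = \pi_tensor t.
Proof. by move=> h; apply/eqmodP/asboolP. Qed.

Lemma tens_eval_repr W (b : {bilinear U -> V -> W}) s :
  tens_eval b (repr (\pi_tensor s)) = tens_eval b s.
Proof.
have /eqmodP/asboolP -> // : \pi_tensor (repr (\pi_tensor s)) = \pi_tensor s.
by rewrite reprK.
Qed.

Definition tens_zero : tensor := \pi_tensor [::].
Definition tens_add (x y : tensor) : tensor := \pi_tensor (repr x ++ repr y).
Definition tens_scale (a : k) (x : tensor) : tensor :=
  \pi_tensor [seq (a *: p.1, p.2) | p <- repr x].
Definition tens_opp (x : tensor) : tensor := tens_scale (-1) x.

Lemma tens_eval_add W (b : {bilinear U -> V -> W}) x y :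
  tens_eval b (repr (tens_add x y)) =
  tens_eval b (repr x) + tens_eval b (repr y).
Proof. by rewrite tens_eval_repr /tens_eval big_cat. Qed.

Lemma tens_eval_scale W (b : {bilinear U -> V -> W}) a x :
  tens_eval b (repr (tens_scale a x)) = a *: tens_eval b (repr x).
Proof.
rewrite tens_eval_repr /tens_eval big_map scaler_sumr.
by apply: eq_bigr => p _; rewrite linearZl_LR.
Qed.

Lemma tens_eval_zero W (b : {bilinear U -> V -> W}) :
  tens_eval b (repr tens_zero) = 0.
Proof. by rewrite tens_eval_repr /tens_eval big_nil. Qed.

Lemma tens_evalP (x y : tensor) :
  (forall W (b : {bilinear U -> V -> W}),
     tens_eval b (repr x) = tens_eval b (repr y)) -> x = y.
Proof. by move=> h; rewrite -[x]reprK -[y]reprK; apply: tens_piP. Qed.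

Let tens_evalE := (tens_eval_add, tens_eval_scale, tens_eval_zero).

Lemma tens_addA : associative tens_add.
Proof. by move=> x y z; apply: tens_evalP => W b; rewrite !tens_evalE addrA. Qed.

Lemma tens_addC : commutative tens_add.
Proof. by move=> x y; apply: tens_evalP => W b; rewrite !tens_evalE addrC. Qed.

Lemma tens_add0 : left_id tens_zero tens_add.
Proof. by move=> x; apply: tens_evalP => W b; rewrite !tens_evalE add0r. Qed.

Lemma tens_addN : left_inverse tens_zero tens_opp tens_add.
Proof.
by move=> x; apply: tens_evalP => W b; rewrite !tens_evalE scaleN1r addNr.
Qed.

HB.instance Definition _ :=
  GRing.isZmodule.Build tensor tens_addA tens_addC tens_add0 tens_addN.

Lemma tens_scaleA a b x : tens_scale a (tens_scale b x) = tens_scale (a * b) x.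
Proof. by apply: tens_evalP => W c; rewrite !tens_evalE scalerA. Qed.

Lemma tens_scale1 : left_id 1 tens_scale.
Proof. by move=> x; apply: tens_evalP => W b; rewrite !tens_evalE scale1r. Qed.

Lemma tens_scaleDr : right_distributive tens_scale +%R.
Proof.
by move=> a x y; apply: tens_evalP => W b; rewrite !tens_evalE scalerDr.
Qed.

Lemma tens_scaleDl x : {morph tens_scale^~ x : a b / a + b}.
Proof.
by move=> a b; apply: tens_evalP => W c; rewrite !tens_evalE scalerDl.
Qed.

HB.instance Definition _ := GRing.Zmodule_isLmodule.Build k tensor
  tens_scaleA tens_scale1 tens_scaleDr tens_scaleDl.

Definition tens (u : U) (v : V) : tensor := \pi_tensor [:: (u, v)].

Lemma tens_eval_tens W (b : {bilinear U -> V -> W}) u v :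
  tens_eval b (repr (tens u v)) = b u v.
Proof. by rewrite tens_eval_repr /tens_eval big_seq1. Qed.

Lemma tens_is_bilinear : bilinear_for *:%R *:%R tens.
Proof.
split=> [v a u u'|u a v v']; apply: tens_evalP => W b.
- by rewrite tens_eval_add tens_eval_scale !tens_eval_tens linearPl.
- by rewrite tens_eval_add tens_eval_scale !tens_eval_tens linearPr.
Qed.

HB.instance Definition _ :=
  bilinear_isBilinear.Build k U V tensor _ _ tens tens_is_bilinear.

Definition tens_lift W (b : {bilinear U -> V -> W}) (x : tensor) : W :=
  tens_eval b (repr x).

Lemma tens_lift_is_linear W (b : {bilinear U -> V -> W}) : linear (tens_lift b).
Proof. by move=> a x y; rewrite /tens_lift tens_eval_add tens_eval_scale. Qed.

HB.instance Definition _ W (b : {bilinear U -> V -> W}) :=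
  GRing.isLinear.Build k tensor W _ (tens_lift b) (tens_lift_is_linear b).

Lemma tens_liftE W (b : {bilinear U -> V -> W}) u v :
  tens_lift b (tens u v) = b u v.
Proof. exact: tens_eval_tens. Qed.

Lemma tens_span (x : tensor) : exists s, x = \sum_(p <- s) tens p.1 p.2.
Proof.
exists (repr x); apply: tens_evalP => W b.
rewrite -[RHS]/(tens_lift b _) linear_sum.
by apply: eq_bigr => p _; rewrite /= tens_liftE.
Qed.

Lemma tens_ext W (f g : {linear tensor -> W}) :
  (forall u v, f (tens u v) = g (tens u v)) -> f =1 g.
Proof.
move=> h x; have [s ->] := tens_span x; rewrite !raddf_sum.
by apply: eq_bigr => p _; apply: h.
Qed.

End Tensor.

Notation "U \otimes V" := (tensor U V) (at level 40, left associativity).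
Notation "u \ox v" := (tens u v) (at level 40, left associativity).

Section TensorMap.
Variables (k : fieldType) (U U' V V' : lmodType k).
Variables (f : {linear U -> U'}) (g : {linear V -> V'}).

Definition tens_map_fun (u : U) (v : V) : U' \otimes V' := f u \ox g v.

Lemma tens_map_is_bilinear : bilinear_for *:%R *:%R tens_map_fun.
Proof.
split=> [v a u u'|u a v v']; rewrite /tens_map_fun linearP.
- exact: linearPl.
- exact: linearPr.
Qed.

HB.instance Definition _ := bilinear_isBilinear.Build k U V
  (U' \otimes V') _ _ tens_map_fun tens_map_is_bilinear.

Definition tens_map : U \otimes V -> U' \otimes V' := tens_lift tens_map_fun.

HB.instance Definition _ := GRing.Linear.on tens_map.

Lemma tens_mapE u v : tens_map (u \ox v) = f u \ox g v.
Proof. exact: tens_liftE. Qed.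

End TensorMap.

Section TensorUnit.
Variables (k : fieldType) (U : lmodType k).

Definition tens_unitl_fun (a : k^o) (u : U) : U := (a : k) *: u.
Definition tens_unitr_fun (u : U) (a : k^o) : U := (a : k) *: u.

Lemma tens_unitl_is_bilinear : bilinear_for *:%R *:%R tens_unitl_fun.
Proof.
split=> [u a b c|b a u v].
- rewrite -[LHS]/((a * (b : k) + (c : k)) *: u) scalerDl -scalerA.
  by [].
- rewrite -[LHS]/((b : k) *: (a *: u + v)) scalerDr !scalerA mulrC -scalerA.
  by [].
Qed.

Lemma tens_unitr_is_bilinear : bilinear_for *:%R *:%R tens_unitr_fun.
Proof. by case: tens_unitl_is_bilinear => hl hr; split. Qed.

HB.instance Definition _ := bilinear_isBilinear.Build k k^o U U _ _
  tens_unitl_fun tens_unitl_is_bilinear.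
HB.instance Definition _ := bilinear_isBilinear.Build k U k^o U _ _
  tens_unitr_fun tens_unitr_is_bilinear.

Definition tens_unitl : k^o \otimes U -> U := tens_lift tens_unitl_fun.
Definition tens_unitr : U \otimes k^o -> U := tens_lift tens_unitr_fun.

HB.instance Definition _ := GRing.Linear.on tens_unitl.
HB.instance Definition _ := GRing.Linear.on tens_unitr.

Lemma tens_unitlE (a : k) u : tens_unitl ((a : k^o) \ox u) = a *: u.
Proof. exact: tens_liftE. Qed.

Lemma tens_unitrE u (a : k) : tens_unitr (u \ox (a : k^o)) = a *: u.
Proof. exact: tens_liftE. Qed.

End TensorUnit.

Section TensorAssoc.
Variables (k : fieldType) (U V W : lmodType k).

Definition tens_assoc_in (w : W) (u : U) (v : V) : U \otimes (V \otimes W) :=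
  u \ox (v \ox w).

Lemma tens_assoc_in_is_bilinear w : bilinear_for *:%R *:%R (tens_assoc_in w).
Proof.
split=> [v a u u'|u a v v']; rewrite /tens_assoc_in.
- exact: linearPl.
- by rewrite linearPl linearPr.
Qed.

HB.instance Definition _ w := bilinear_isBilinear.Build k U V
  (U \otimes (V \otimes W)) _ _ (tens_assoc_in w)
  (tens_assoc_in_is_bilinear w).

Definition tens_assoc_fun (x : U \otimes V) (w : W) : U \otimes (V \otimes W) :=
  tens_lift (tens_assoc_in w) x.

Lemma tens_assoc_is_bilinear : bilinear_for *:%R *:%R tens_assoc_fun.
Proof.
split=> [w a x y|x a w w']; rewrite /tens_assoc_fun; first exact: linearP.
have [s ->] := tens_span x; rewrite !linear_sum /= scaler_sumr -big_split /=.
by apply: eq_bigr => p _; rewrite !tens_liftE /= /tens_assoc_in !linearPr.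
Qed.

HB.instance Definition _ := bilinear_isBilinear.Build k (U \otimes V) W
  (U \otimes (V \otimes W)) _ _ tens_assoc_fun tens_assoc_is_bilinear.

Definition tens_assoc : U \otimes V \otimes W -> U \otimes (V \otimes W) :=
  tens_lift tens_assoc_fun.

HB.instance Definition _ := GRing.Linear.on tens_assoc.

Lemma tens_assocE u v w :
  tens_assoc (u \ox v \ox w) = u \ox (v \ox w).
Proof. by rewrite /tens_assoc tens_liftE /= /tens_assoc_fun tens_liftE. Qed.

End TensorAssoc.

Arguments tens_assoc {k U V W}.
Arguments tens_unitl {k U}.
Arguments tens_unitr {k U}.

Record is_coalgebra (k : fieldType) (U : lmodType k)
    (Delta : {linear U -> U \otimes U}) (eps : {linear U -> k^o}) : Prop := {
  coalg_assoc : forall u,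
    tens_assoc (tens_map Delta idfun (Delta u)) = tens_map idfun Delta (Delta u);
  coalg_counitl : forall u, tens_unitl (tens_map eps idfun (Delta u)) = u;
  coalg_counitr : forall u, tens_unitr (tens_map idfun eps (Delta u)) = u
}.

Section EndCoalgebra.
Variables (k : fieldType) (V : vectType k).
Implicit Types (beta : 'Hom(V, k^o)) (x : V) (T : 'End(V)).

Definition rank_one beta x : 'End(V) := linfun (fun y => beta y *: x).

Definition dual_vec n (e : n.-tuple V) (i : 'I_n) : 'Hom(V, k^o) :=
  linfun (coord e i : V -> k^o).

(* The prescriptions beta (x) x |-> \sum_i (beta (x) e_i) (x) (e^i (x) x) and
   beta (x) x |-> beta x, extended along T = \sum_j e^j (x) T e_j for the
   library's basis e of V.  See [End_comult_rank_one] (any basis) and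
   [End_counit_rank_one]; these determine both maps by [rank_one_sum]. *)
Definition End_comult T : 'End(V) \otimes 'End(V) :=
  let e := vbasis {:V} in
  \sum_(i < \dim {:V}) \sum_(j < \dim {:V})
    rank_one (dual_vec e j) e`_i \ox
    rank_one (dual_vec e i) (T e`_j).

Definition End_counit T : k^o :=
  let e := vbasis {:V} in \sum_(j < \dim {:V}) dual_vec e j (T e`_j).

Lemma rank_oneE beta x y : rank_one beta x y = beta y *: x.
Proof.
have lin : linear (fun y => beta y *: x).
  by move=> a u v; rewrite linearP scalerDl scalerA.
pose h := GRing.isLinear.Build k V V _ (fun y => beta y *: x) lin.
pose f : {linear V -> V} := HB.pack (fun y => beta y *: x) h.
exact: (lfunE f).
Qed.

Lemma rank_one_is_bilinear : bilinear_for *:%R *:%R rank_one.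
Proof.
split=> [x a b c|b a x y]; apply/lfunP => z.
- rewrite !(add_lfunE, scale_lfunE, rank_oneE) scalerDl; congr (_ + _).
  by rewrite scalerA.
- by rewrite !(add_lfunE, scale_lfunE, rank_oneE) scalerDr !scalerA mulrC.
Qed.

HB.instance Definition _ := bilinear_isBilinear.Build k 'Hom(V, k^o) V 'End(V)
  _ _ rank_one rank_one_is_bilinear.

Lemma dual_vecE n (e : n.-tuple V) i y : dual_vec e i y = coord e i y.
Proof. exact: lfunE. Qed.

Lemma rank_one_sum n (e : n.-tuple V) T : basis_of {:V} e ->
  T = \sum_(j < n) rank_one (dual_vec e j) (T e`_j).
Proof.
move=> be; apply/lfunP => y; rewrite sum_lfunE {1}(coord_basis be (memvf y)).
rewrite raddf_sum; apply: eq_bigr => j _.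
by rewrite /= linearZ rank_oneE dual_vecE.
Qed.

Lemma dual_vec_sum n (e : n.-tuple V) beta : basis_of {:V} e ->
  beta = \sum_(j < n) beta e`_j *: dual_vec e j.
Proof.
move=> be; apply/lfunP => y; rewrite sum_lfunE {1}(coord_basis be (memvf y)).
rewrite raddf_sum; apply: eq_bigr => j _.
by rewrite /= linearZ /= lfunE /= dual_vecE [LHS]mulrC.
Qed.

Lemma End_comult_is_linear : linear End_comult.
Proof.
move=> a S T; rewrite /End_comult scaler_sumr -big_split /=.
apply: eq_bigr => i _; rewrite scaler_sumr -big_split /=.
by apply: eq_bigr => j _; rewrite !lfunE /= !lfunE /= !linearPr.
Qed.

HB.instance Definition _ := GRing.isLinear.Build k 'End(V)
  ('End(V) \otimes 'End(V)) _ End_comult End_comult_is_linear.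

Lemma End_counit_is_linear : linear End_counit.
Proof.
move=> a S T; rewrite /End_counit scaler_sumr -big_split /=.
by apply: eq_bigr => j _; rewrite !lfunE /= !lfunE /= linearP.
Qed.

HB.instance Definition _ := GRing.isLinear.Build k 'End(V) k^o _
  End_counit End_counit_is_linear.

Lemma End_comult_rank_one n (e : n.-tuple V) beta x : basis_of {:V} e ->
  End_comult (rank_one beta x) =
  \sum_(i < n) rank_one beta e`_i \ox rank_one (dual_vec e i) x.
Proof.
move=> be; have bv := vbasisP {:V}; set v := vbasis {:V} in bv.
transitivity
  (\sum_(i < \dim {:V}) rank_one beta v`_i \ox rank_one (dual_vec v i) x).
  apply: eq_bigr => i _; rewrite {2}(dual_vec_sum beta bv).
  rewrite linear_sumlz linear_sumlz; apply: eq_bigr => j _.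
  by rewrite rank_oneE linearZr_LR linearZr_LR !linearZl_LR.
have vE (i : 'I_(\dim {:V})) : v`_i = \sum_(j < n) coord e j v`_i *: e`_j.
  exact: coord_basis be (memvf _).
have eE j : dual_vec e j = \sum_(i < \dim {:V}) coord e j v`_i *: dual_vec v i.
  rewrite {1}(dual_vec_sum (dual_vec e j) bv).
  by apply: eq_bigr => i _; rewrite dual_vecE.
transitivity (\sum_(i < \dim {:V}) \sum_(j < n) coord e j v`_i *:
    (rank_one beta e`_j \ox rank_one (dual_vec v i) x)).
  apply: eq_bigr => i _; rewrite {1}vE linear_sumr linear_sumlz.
  by apply: eq_bigr => j _; rewrite linearZr_LR linearZl_LR.
rewrite exchange_big; apply: eq_bigr => j _ /=.
rewrite eE linear_sumlz linear_sumr.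
by apply: eq_bigr => i _; rewrite linearZl_LR linearZr_LR.
Qed.

Lemma End_counit_rank_one beta x : End_counit (rank_one beta x) = beta x.
Proof.
have bv := vbasisP {:V}; rewrite {2}(dual_vec_sum beta bv) sum_lfunE.
apply: eq_bigr => j _; rewrite rank_oneE scale_lfunE.
exact: linearZ.
Qed.

End EndCoalgebra.

(* [compose g f] is the composite "g after f". *)
Record linear_category (k : fieldType) := LinearCategory {
  obj :> Type;
  hom : obj -> obj -> lmodType k;
  idm : forall X, hom X X;
  compose : forall X Y Z, hom Y Z -> hom X Y -> hom X Z;
  compose_idl : forall X Y (f : hom X Y), compose (idm Y) f = f;
  compose_idr : forall X Y (f : hom X Y), compose f (idm X) = f;
  composeA : forall X Y Z W (h : hom Z W) (g : hom Y Z) (f : hom X Y),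
    compose h (compose g f) = compose (compose h g) f;
  compose_bilinear : forall X Y Z,
    bilinear_for *:%R *:%R (@compose X Y Z)
}.

Arguments hom {k} _ _ _.
Arguments idm {k} _ _.
Arguments compose {k _ X Y Z}.

Section Abelian.
Variables (k : fieldType) (C : linear_category k).

Definition is_zero_obj (Z : C) : Prop :=
  forall X, (forall f : hom C X Z, f = 0) /\ (forall f : hom C Z X, f = 0).

Definition is_biproduct (X Y P : C) (i1 : hom C X P) (i2 : hom C Y P)
    (p1 : hom C P X) (p2 : hom C P Y) : Prop :=
  [/\ compose p1 i1 = idm C X, compose p2 i2 = idm C Y,
      compose p1 i2 = 0, compose p2 i1 = 0 &
      compose i1 p1 + compose i2 p2 = idm C P].

Definition monic X Y (f : hom C X Y) : Prop :=
  forall Z (g h : hom C Z X), compose f g = compose f h -> g = h.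

Definition epic X Y (f : hom C X Y) : Prop :=
  forall Z (g h : hom C Y Z), compose g f = compose h f -> g = h.

Definition is_kernel X Y (f : hom C X Y) K (m : hom C K X) : Prop :=
  compose f m = 0 /\
  forall Z (g : hom C Z X), compose f g = 0 -> exists! h, compose m h = g.

Definition is_cokernel X Y (f : hom C X Y) Q (q : hom C Y Q) : Prop :=
  compose q f = 0 /\
  forall Z (g : hom C Y Z), compose g f = 0 -> exists! h, compose h q = g.

Record is_abelian : Prop := {
  ab_zero : exists Z, is_zero_obj Z;
  ab_biproduct : forall X Y, exists P i1 i2 p1 p2, @is_biproduct X Y P i1 i2 p1 p2;
  ab_kernel : forall X Y (f : hom C X Y), exists K (m : hom C K X), is_kernel f m;
  ab_cokernel : forall X Y (f : hom C X Y),
    exists Q (q : hom C Y Q), is_cokernel f q;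
  ab_monic : forall X Y (m : hom C X Y), monic m ->
    exists Z (f : hom C Y Z), is_kernel f m;
  ab_epic : forall X Y (q : hom C X Y), epic q ->
    exists Z (f : hom C Z X), is_cokernel f q
}.

End Abelian.

(* Linearity is bundled in [fmap]; finite-dimensionality of the values is carried
   by [vectType]. *)
Record fd_functor (k : fieldType) (C : linear_category k) := FdFunctor {
  fobj :> C -> vectType k;
  fmap : forall X Y, {linear hom C X Y -> 'Hom(fobj X, fobj Y)};
  fmap_id : forall X, fmap X X (idm C X) = \1%VF;
  fmap_comp : forall X Y Z (g : hom C Y Z) (f : hom C X Y),
    fmap X Z (compose g f) = (fmap Y Z g \o fmap X Y f)%VF
}.

Arguments fmap {k C} _ {X Y}.

Section Coend.
Variables (k : fieldType) (C : linear_category k) (F : fd_functor C).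

Definition dinatural (W : lmodType k) (i : forall X, {linear 'End(F X) -> W}) :
    Prop :=
  forall (X Y : C) (f : hom C Y X) (T : 'Hom(F X, F Y)),
    i X (fmap F f \o T)%VF = i Y (T \o fmap F f)%VF.

Definition is_coend (U : lmodType k) (i : forall X, {linear 'End(F X) -> U}) :
    Prop :=
  dinatural i /\
  forall (W : lmodType k) (j : forall X, {linear 'End(F X) -> W}),
    dinatural j ->
    exists2 phi : {linear U -> W}, (forall X, phi \o i X =1 j X) &
      forall psi : {linear U -> W}, (forall X, psi \o i X =1 j X) -> psi =1 phi.

End Coend.

(* Main.v *)
Require Import Defs.
From HB Require Import structures.
From mathcomp Require Import all_boot all_order all_algebra.
From mathcomp Require Import boolp.

Set Implicit Arguments.
Unset Strict Implicit.
Unset Printing Implicit Defensive.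

Import GRing.Theory.
Local Open Scope ring_scope.

(** The coend is the quotient of the sum of the spaces [End (F X)] that makes
    the inclusions dinatural, so a linear map out of [U] is the same as a
    dinatural family of maps out of the [End (F X)], and two linear maps out
    of [U] agree as soon as they agree after every [i X] ([coend_ext]).  The
    existence and uniqueness of [Delta] and [eps] thus reduce to the
    dinaturality of [(i X (x) i X) o Delta_X] and of [epsilon_X], and the
    coalgebra axioms for [U] reduce to those for the [End (F X)].

    Since the spaces of linear maps are spanned by maps of rank one,
    dinaturality says that [i X (beta (x) phi y) = i Y ((beta o phi) (x) y)]
    for [phi = F f : F Y -> F X] ([dinatural_rank_one]).  For [epsilon] both
    sides are [beta (phi y)].  For [Delta], with bases [e] of [F X] and [d] of
    [F Y], using dinaturality of [i] once on each side turns the claim into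

      \sum_i i X (beta (x) e_i) (x) i Y ((e^i o phi) (x) y)
      = \sum_j i X (beta (x) phi d_j) (x) i Y (d^j (x) y),

    which is the image under a linear map of
    [\sum_i e_i (x) (e^i o phi) = \sum_j phi d_j (x) d^j]: both are the tensor
    that represents [phi] in [F X (x) (F Y)^*] ([canonical_tensor_natural]).

    Finally [End V] is a coalgebra by direct computation on rank-one maps
    ([End_is_coalgebra]), and a linear map compatible with comultiplications
    and counits carries the axioms over to its image ([coalgebra_on_image]);
    the images of the [i X] together determine linear maps out of [U]. *)

(** * Functoriality and naturality of tensor products *)

Section TensorNaturality.
Variable k : fieldType.

Lemma tens_map_comp (U U' U'' V V' V'' : lmodType k)
    (f : {linear U -> U'}) (f' : {linear U' -> U''})
    (g : {linear V -> V'}) (g' : {linear V' -> V''}) :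
  tens_map f' g' \o tens_map f g =1 tens_map (f' \o f) (g' \o g).
Proof. by apply: tens_ext => u v; rewrite /= !tens_mapE. Qed.

Lemma tens_map_sum (U U' V V' : lmodType k)
    (f : {linear U -> U'}) (g : {linear V -> V'}) n
    (u : 'I_n -> U) (v : 'I_n -> V) :
  tens_map f g (\sum_(i < n) u i \ox v i) = \sum_(i < n) f (u i) \ox g (v i).
Proof. by rewrite linear_sum; apply: eq_bigr => i _; rewrite /= tens_mapE. Qed.

Lemma eq_tens_map (U U' V V' : lmodType k)
    (f f' : {linear U -> U'}) (g g' : {linear V -> V'}) :
  f =1 f' -> g =1 g' -> tens_map f g =1 tens_map f' g'.
Proof.
by move=> ff' gg'; apply: tens_ext => u v; rewrite /= !tens_mapE ff' gg'.
Qed.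

Lemma tens_ext3 (U V W Z : lmodType k)
    (f g : {linear U \otimes V \otimes W -> Z}) :
  (forall u v w, f (u \ox v \ox w) = g (u \ox v \ox w)) -> f =1 g.
Proof.
move=> fg; apply: tens_ext => x w.
pose tw := applyr (@tens k (U \otimes V) W) w.
exact: (tens_ext (f := f \o tw) (g := g \o tw)) (fun u v => fg u v w) x.
Qed.

Lemma tens_assoc_natural (U U' V V' W W' : lmodType k)
    (f : {linear U -> U'}) (g : {linear V -> V'}) (h : {linear W -> W'}) :
  tens_assoc \o tens_map (tens_map f g) h
  =1 tens_map f (tens_map g h) \o tens_assoc.
Proof.
apply: tens_ext3 => u v w.
by rewrite /= tens_mapE /= tens_mapE !tens_assocE !tens_mapE /= tens_mapE.
Qed.

Lemma tens_unitl_natural (U U' : lmodType k) (f : {linear U -> U'}) :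
  tens_unitl \o tens_map idfun f =1 f \o tens_unitl.
Proof. by apply: tens_ext => a u; rewrite /= tens_mapE !tens_unitlE linearZ. Qed.

Lemma tens_unitr_natural (U U' : lmodType k) (f : {linear U -> U'}) :
  tens_unitr \o tens_map f idfun =1 f \o tens_unitr.
Proof. by apply: tens_ext => u a; rewrite /= tens_mapE !tens_unitrE linearZ. Qed.

End TensorNaturality.

(** * The coalgebra of endomorphisms of a finite-dimensional space *)

Section FiniteDimensional.
Variable k : fieldType.

Lemma outer_linear (V W : vectType k) (beta : 'Hom(V, k^o)) (y : W) :
  linear (fun z => beta z *: y).
Proof. by move=> a u v; rewrite linearP scalerDl scalerA. Qed.

Lemma compose_as_rank_ones (V W : vectType k) (phi : 'Hom(V, W))
    (T : 'Hom(W, V)) n (e : n.-tuple W) : basis_of {:W} e ->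
  (T \o phi)%VF = \sum_(j < n) rank_one (dual_vec e j \o phi)%VF (T e`_j).
Proof.
move=> be; apply/lfunP => z; rewrite sum_lfunE comp_lfunE.
rewrite {1}(coord_basis be (memvf (phi z))) linear_sum.
by apply: eq_bigr => j _; rewrite linearZ rank_oneE comp_lfunE dual_vecE.
Qed.

(** Both sides are the tensor of [W (x) V^*] that represents [phi]; expanding
    them in the two bases gives the matrix of [phi].  For [phi] the identity
    this is the basis independence of the canonical element. *)
Lemma canonical_tensor_natural (V W : vectType k) (phi : 'Hom(V, W))
    n (e : n.-tuple W) m (d : m.-tuple V) :
  basis_of {:W} e -> basis_of {:V} d ->
  \sum_(i < n) e`_i \ox (dual_vec e i \o phi)%VF
  = \sum_(j < m) phi d`_j \ox dual_vec d j.
Proof.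
move=> be bd.
transitivity (\sum_(i < n) \sum_(j < m)
    coord e i (phi d`_j) *: (e`_i \ox dual_vec d j)).
  apply: eq_bigr => i _; rewrite (dual_vec_sum (_ \o phi)%VF bd) linear_sumr.
  by apply: eq_bigr => j _; rewrite comp_lfunE linearZr_LR dual_vecE.
rewrite exchange_big; apply: eq_bigr => j _ /=.
rewrite {2}(coord_basis be (memvf (phi d`_j))) linear_sumlz.
by apply: eq_bigr => i _; rewrite linearZl_LR.
Qed.

Lemma rank_one_ext (V : vectType k) (W : lmodType k)
    (f g : {linear 'End(V) -> W}) :
  (forall beta x, f (rank_one beta x) = g (rank_one beta x)) -> f =1 g.
Proof.
move=> fg T; rewrite (rank_one_sum T (vbasisP {:V})) !linear_sum.
by apply: eq_bigr => j _; apply: fg.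
Qed.

(** On a rank-one map, both sides of coassociativity are
    [\sum_l \sum_i (beta (x) e_l) (x) (e^l (x) e_i) (x) (e^i (x) x)], and
    the counit laws are the expansions of [beta] and of [x] in the bases [e^i]
    and [e_i]. *)
Lemma End_is_coalgebra (V : vectType k) :
  is_coalgebra (@End_comult k V) (@End_counit k V).
Proof.
have be := vbasisP {:V}; set e := vbasis {:V} in be.
split.
- apply: (rank_one_ext
    (f := tens_assoc \o (tens_map (@End_comult k V) idfun \o @End_comult k V))
    (g := tens_map idfun (@End_comult k V) \o @End_comult k V)) => beta x /=.
  rewrite (End_comult_rank_one _ _ be) !tens_map_sum linear_sum /=.
  transitivity (\sum_(i < \dim {:V}) \sum_(l < \dim {:V})
    rank_one beta e`_l \ox
      (rank_one (dual_vec e l) e`_i \ox rank_one (dual_vec e i) x)).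
    apply: eq_bigr => i _; rewrite (End_comult_rank_one _ _ be).
    rewrite linear_sumlz linear_sum.
    by apply: eq_bigr => l _; rewrite /= tens_assocE.
  rewrite exchange_big; apply: eq_bigr => l _ /=.
  by rewrite (End_comult_rank_one _ _ be) linear_sumr.
- apply: (rank_one_ext (g := idfun)
    (f := tens_unitl \o (tens_map (@End_counit k V) idfun \o @End_comult k V)))
    => beta x /=.
  rewrite (End_comult_rank_one _ _ be) tens_map_sum linear_sum /=.
  rewrite {2}(dual_vec_sum beta be) linear_sumlz; apply: eq_bigr => i _.
  by rewrite tens_unitlE End_counit_rank_one linearZl_LR.
- apply: (rank_one_ext (g := idfun)
    (f := tens_unitr \o (tens_map idfun (@End_counit k V) \o @End_comult k V)))
    => beta x /=.
  rewrite (End_comult_rank_one _ _ be) tens_map_sum linear_sum /=.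
  rewrite {2}(coord_basis be (memvf x)) linear_sumr; apply: eq_bigr => i _.
  by rewrite tens_unitrE End_counit_rank_one linearZr_LR dual_vecE.
Qed.

End FiniteDimensional.

(** * Transporting the coalgebra axioms along a map *)

(** Each axiom is an equality between two composites natural in the coalgebra,
    so [f] pushes it from [A] forward to the elements [f a].  The target is
    only a space with two linear maps: for the coend, the axioms must be known
    on the images of the [i X] before they are known on all of [U]. *)
Lemma coalgebra_on_image (k : fieldType) (A U : lmodType k)
    (DeltaA : {linear A -> A \otimes A}) (epsA : {linear A -> k^o})
    (DeltaU : {linear U -> U \otimes U}) (epsU : {linear U -> k^o})
    (f : {linear A -> U}) :
  is_coalgebra DeltaA epsA ->
  DeltaU \o f =1 tens_map f f \o DeltaA -> epsU \o f =1 epsA ->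
  forall a, [/\ tens_assoc (tens_map DeltaU idfun (DeltaU (f a)))
                = tens_map idfun DeltaU (DeltaU (f a)),
                tens_unitl (tens_map epsU idfun (DeltaU (f a))) = f a
              & tens_unitr (tens_map idfun epsU (DeltaU (f a))) = f a].
Proof.
move=> [coassoc counitl counitr] fD feps a.
have -> : DeltaU (f a) = tens_map f f (DeltaA a) := fD a.
split.
- transitivity (tens_map f (tens_map f f)
    (tens_assoc (tens_map DeltaA idfun (DeltaA a)))).
    rewrite -[RHS]tens_assoc_natural /=; congr (tens_assoc _).
    rewrite [LHS]tens_map_comp [RHS]tens_map_comp.
    exact: eq_tens_map.
  rewrite coassoc [LHS]tens_map_comp [RHS]tens_map_comp.
  by apply: eq_tens_map => // b; rewrite -[LHS]fD.
- rewrite -[in RHS](counitl a) -[RHS]tens_unitl_natural /=; congr (tens_unitl _).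
  by rewrite [LHS]tens_map_comp [RHS]tens_map_comp; apply: eq_tens_map.
- rewrite -[in RHS](counitr a) -[RHS]tens_unitr_natural /=; congr (tens_unitr _).
  by rewrite [LHS]tens_map_comp [RHS]tens_map_comp; apply: eq_tens_map.
Qed.

(** * Dinatural families and the coend *)

Section CoendCoalgebra.
Variables (k : fieldType) (C : linear_category k) (F : fd_functor C).

(** Both sides of dinaturality are linear in [T : F X -> F Y], and the maps
    [z |-> beta z *: y] span these [T]. *)
Lemma dinatural_rank_one (W : lmodType k)
    (i : forall X, {linear 'End(F X) -> W}) :
  dinatural i <->
  forall (X Y : C) (f : Defs.hom C Y X) (beta : 'Hom(F X, k^o)) (y : F Y),
    i X (rank_one beta (fmap F f y))
    = i Y (rank_one (beta \o fmap F f)%VF y).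
Proof.
split=> [din X Y f beta y | din X Y f T].
  pose h := GRing.isLinear.Build k (F X) (F Y) _ _ (outer_linear beta y).
  pose t : {linear F X -> F Y} := HB.pack (fun z => beta z *: y) h.
  have := din X Y f (linfun t); congr (i X _ = i Y _); apply/lfunP => z.
  - by rewrite rank_oneE comp_lfunE lfunE linearZ.
  - by rewrite rank_oneE !comp_lfunE lfunE.
have be := vbasisP {:F X}.
rewrite (compose_as_rank_ones (fmap F f) T be) (rank_one_sum (_ \o T)%VF be).
by rewrite !linear_sum; apply: eq_bigr => j _; rewrite comp_lfunE din.
Qed.

Section Dinatural.
Variables (U : lmodType k) (i : forall X, {linear 'End(F X) -> U}).

(** Dinaturality of [i] moves [fmap F f] across one tensor factor on each side;
    the two sums that remain are images of the two expressions of the tensor of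
    [fmap F f] in [canonical_tensor_natural]. *)
Lemma comult_dinatural : dinatural i ->
  dinatural (fun X => tens_map (i X) (i X) \o @End_comult k (F X)).
Proof.
move=> /dinatural_rank_one din; apply/dinatural_rank_one => X Y f beta y /=.
have be := vbasisP {:F X}; have bd := vbasisP {:F Y}.
rewrite (End_comult_rank_one _ _ be) (End_comult_rank_one _ _ bd).
rewrite !tens_map_sum.
(* The linear structure of a partial application is only inferred when the
   bilinear map appears in bundled form. *)
pose r (V : vectType k) : {bilinear 'Hom(V, k^o) -> V -> 'End(V)} :=
  @rank_one k V.
have := congr1 (tens_map (i X \o r (F X) beta) (i Y \o applyr (r (F Y)) y))
  (canonical_tensor_natural (fmap F f) be bd).
rewrite !tens_map_sum; by congr (_ = _); apply: eq_bigr => j _; rewrite /= din.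
Qed.

Lemma counit_dinatural : dinatural (fun X => @End_counit k (F X)).
Proof.
apply/dinatural_rank_one => X Y f beta y.
by rewrite /= !End_counit_rank_one comp_lfunE.
Qed.

(** The family [g \o i X] is dinatural because [i] is, and [f] and [g] are both
    factorizations of it through the coend. *)
Lemma coend_ext (coend_i : is_coend i) (W : lmodType k)
    (f g : {linear U -> W}) :
  (forall X, f \o i X =1 g \o i X) -> f =1 g.
Proof.
case: coend_i => din univ fg.
have [|phi _ uniq] := univ W (fun X => g \o i X).
  by move=> X Y h T /=; rewrite din.
by move=> u; rewrite (uniq f fg) (uniq g).
Qed.

End Dinatural.
End CoendCoalgebra.

Theorem proposition2p7 (k : fieldType) (C : linear_category k)
    (abC : is_abelian C) (F : fd_functor C)
    (U : lmodType k) (i : forall X : C, {linear 'End(F X) -> U})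
    (coend_i : is_coend i) :
  exists (Delta : {linear U -> U \otimes U}) (eps : {linear U -> k^o}),
    [/\ forall X : C, Delta \o i X =1 tens_map (i X) (i X) \o @End_comult k (F X),
        forall X : C, eps \o i X =1 @End_counit k (F X),
        forall Delta' : {linear U -> U \otimes U},
          (forall X : C,
            Delta' \o i X =1 tens_map (i X) (i X) \o @End_comult k (F X)) ->
          Delta' =1 Delta,
        forall eps' : {linear U -> k^o},
          (forall X : C, eps' \o i X =1 @End_counit k (F X)) -> eps' =1 eps
      & is_coalgebra Delta eps].
Proof.
have [din univ] := coend_i.
have [Delta DeltaE Delta_uniq] := univ _ _ (comult_dinatural din).
have [eps epsE eps_uniq] := univ _ _ (@counit_dinatural k C F).
exists Delta, eps; split=> //.
have ax X T := coalgebra_on_image (End_is_coalgebra (F X)) (DeltaE X) (epsE X) T.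
split.
- apply: (coend_ext coend_i
    (f := tens_assoc \o (tens_map Delta idfun \o Delta))
    (g := tens_map idfun Delta \o Delta)) => X T.
  by case: (ax X T).
- apply: (coend_ext coend_i (g := idfun)
    (f := tens_unitl \o (tens_map eps idfun \o Delta))) => X T.
  by case: (ax X T).
- apply: (coend_ext coend_i (g := idfun)
    (f := tens_unitr \o (tens_map idfun eps \o Delta))) => X T.
  by case: (ax X T).
Qed.
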